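(* Let $\mathcal{C}$ be a triangulated category with shift functor $[1]$, and let $\mathcal{M}\subseteq\mathcal{Z}$ be full additive (not necessarily triangulated) subcategories of $\mathcal{C}$. Assume the following. (1) $\mathcal{M}$ is functorially finite in $\mathcal{Z}$: every $Z\in\mathcal{Z}$ admits a left $\mathcal{M}$-approximation $Z\to M_Z$ and a right $\mathcal{M}$-approximation $N_Z\to Z$. (2a) Whenever $f\colon Z_1\to Z_2$ is an $\mathcal{M}$-monomorphism with $Z_1,Z_2\in\mathcal{Z}$ and $Z_1\xrightarrow{f}Z_2\xrightarrow{g}C\xrightarrow{h}Z_1[1]$ is a triangle in $\mathcal{C}$, then $C\in\mathcal{Z}$ and $g$ is an $\mathcal{M}$-epimorphism. (2b) Whenever $g\colon Z_2\to Z_3$ is an $\mathcal{M}$-epimorphism with $Z_2,Z_3\in\mathcal{Z}$ and $B\xrightarrow{f}Z_2\xrightarrow{g}Z_3\xrightarrow{h}B[1]$ is a triangle in $\mathcal{C}$, then $B\in\mathcal{Z}$ and $f$ is an $\mathcal{M}$-monomorphism. Then the additive quotient category $\mathcal{Z}/[\mathcal{M}]$ has the structure of a triangulated category.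
   Context: A morphism $f\colon A\to B$ in $\mathcal{C}$ is an $\mathcal{M}$-monomorphism if for every $M\in\mathcal{M}$ the map $\mathrm{Hom}_{\mathcal{C}}(B,M)\to\mathrm{Hom}_{\mathcal{C}}(A,M)$ given by precomposition with $f$ is surjective. It is an $\mathcal{M}$-epimorphism if for every $M\in\mathcal{M}$ the map $\mathrm{Hom}_{\mathcal{C}}(M,A)\to\mathrm{Hom}_{\mathcal{C}}(M,B)$ given by postcomposition with $f$ is surjective. A left $\mathcal{M}$-approximation of $A$ is an $\mathcal{M}$-monomorphism $A\to B$ with $B\in\mathcal{M}$; a right $\mathcal{M}$-approximation of $B$ is an $\mathcal{M}$-epimorphism $A\to B$ with $A\in\mathcal{M}$. The category $\mathcal{Z}/[\mathcal{M}]$ has the same objects as $\mathcal{Z}$, and $\mathrm{Hom}_{\mathcal{Z}/[\mathcal{M}]}(X,Y):=\mathrm{Hom}_{\mathcal{Z}}(X,Y)/\mathcal{M}(X,Y)$, where $\mathcal{M}(X,Y)$ is the subgroup of morphisms that factor through an object of $\mathcal{M}$. *)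

(* Defs.v *)
From HB Require Import structures.
From mathcomp Require Import all_boot all_algebra.
From mathcomp Require Import boolp.

Set Implicit Arguments.
Unset Strict Implicit.
Unset Printing Implicit Defensive.

Import GRing.Theory.

Local Open Scope ring_scope.

(* Categories enriched in abelian groups. [mcomp f g] is g after f, but it is
   always written in the usual order, as [g \oc f]. *)
Record preadd_category := PreaddCategory {
  ob :> Type;
  Mor : ob -> ob -> zmodType;
  idm : forall X : ob, Mor X X;
  mcomp : forall X Y Z : ob, Mor X Y -> Mor Y Z -> Mor X Z;
  mcomp1m : forall (X Y : ob) (f : Mor X Y), mcomp (idm X) f = f;
  mcompm1 : forall (X Y : ob) (f : Mor X Y), mcomp f (idm Y) = f;
  mcompA : forall (W X Y Z : ob) (f : Mor W X) (g : Mor X Y) (h : Mor Y Z),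
    mcomp f (mcomp g h) = mcomp (mcomp f g) h;
  mcompDl : forall (X Y Z : ob) (f f' : Mor X Y) (g : Mor Y Z),
    mcomp (f + f') g = mcomp f g + mcomp f' g;
  mcompDr : forall (X Y Z : ob) (f : Mor X Y) (g g' : Mor Y Z),
    mcomp f (g + g') = mcomp f g + mcomp f g'
}.

Arguments Mor {p} X Y.
Arguments idm {p} X.
Arguments mcomp {p X Y Z} f g.

Notation "g \oc f" := (mcomp f g) (at level 40, left associativity).

Definition is_zero_ob (C : preadd_category) (O : C) : Prop :=
  forall X : C, (forall f : Mor O X, f = 0) /\ (forall f : Mor X O, f = 0).

Definition is_biproduct (C : preadd_category) (X Y S : C) : Prop :=
  exists (i1 : Mor X S) (i2 : Mor Y S) (p1 : Mor S X) (p2 : Mor S Y),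
    [/\ p1 \oc i1 = idm X, p2 \oc i2 = idm Y, p2 \oc i1 = 0, p1 \oc i2 = 0
      & i1 \oc p1 + i2 \oc p2 = idm S].

Record add_category := AddCategory {
  preadd_category_of :> preadd_category;
  has_zero_ob : exists O : preadd_category_of, is_zero_ob O;
  has_biproduct : forall X Y : preadd_category_of,
    exists S : preadd_category_of, is_biproduct X Y S
}.

(* Full additive subcategories, not assumed to be closed under isomorphisms
   or under direct summands. *)
Record add_subcat (C : add_category) := AddSubcat {
  in_subcat :> C -> Prop;
  subcat_zero : exists O : C, in_subcat O /\ is_zero_ob O;
  subcat_biproduct : forall X Y : C, in_subcat X -> in_subcat Y ->
    exists S : C, in_subcat S /\ is_biproduct X Y S
}.

Definition is_iso (C : preadd_category) (X Y : C) (f : Mor X Y) : Prop :=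
  exists g : Mor Y X, g \oc f = idm X /\ f \oc g = idm Y.

Record add_functor (C D : preadd_category) := AddFunctor {
  fob :> C -> D;
  fmap : forall X Y : C, Mor X Y -> Mor (fob X) (fob Y);
  fmap1 : forall X : C, fmap (idm X) = idm (fob X);
  fmap_comp : forall (X Y Z : C) (f : Mor X Y) (g : Mor Y Z),
    fmap (g \oc f) = fmap g \oc fmap f;
  fmapD : forall (X Y : C) (f g : Mor X Y), fmap (f + g) = fmap f + fmap g
}.

Arguments fmap {C D} F {X Y} f : rename.

(* F is an equivalence: G is a quasi-inverse, with natural isomorphisms
   eta : 1 -> GF and eps : FG -> 1. *)
Definition is_equivalence (C D : preadd_category) (F : add_functor C D) : Prop :=
  exists (G : add_functor D C)
         (eta : forall X : C, Mor X (G (F X)))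
         (eps : forall Y : D, Mor (F (G Y)) Y),
    [/\ (forall X : C, is_iso (eta X)),
        (forall Y : D, is_iso (eps Y)),
        (forall (X X' : C) (f : Mor X X'),
           eta X' \oc f = fmap G (fmap F f) \oc eta X)
      & (forall (Y Y' : D) (g : Mor Y Y'),
           g \oc eps Y = eps Y' \oc fmap F (fmap G g))].

(* The shift is an autoequivalence, not necessarily an automorphism: the shift
   induced on a quotient category is in general not bijective on objects. *)
Record triangulation (C : add_category) := Triangulation {
  shift : add_functor C C;
  (* [triangle f g h] : X -f-> Y -g-> Z -h-> X[1] is a distinguished triangle *)
  triangle : forall X Y Z : C,
    Mor X Y -> Mor Y Z -> Mor Z (shift X) -> Prop;
  shift_equivalence : is_equivalence shift;
  triangle_iso : forall (X Y Z X' Y' Z' : C)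
      (f : Mor X Y) (g : Mor Y Z) (h : Mor Z (shift X))
      (f' : Mor X' Y') (g' : Mor Y' Z') (h' : Mor Z' (shift X'))
      (a : Mor X X') (b : Mor Y Y') (c : Mor Z Z'),
    is_iso a -> is_iso b -> is_iso c ->
    b \oc f = f' \oc a -> c \oc g = g' \oc b -> fmap shift a \oc h = h' \oc c ->
    triangle f g h -> triangle f' g' h';
  triangle_id : forall X O : C, is_zero_ob O ->
    triangle (idm X) (0 : Mor X O) (0 : Mor O (shift X));
  triangle_cone : forall (X Y : C) (f : Mor X Y),
    exists (Z : C) (g : Mor Y Z) (h : Mor Z (shift X)), triangle f g h;
  triangle_rot : forall (X Y Z : C)
      (f : Mor X Y) (g : Mor Y Z) (h : Mor Z (shift X)),
    triangle f g h <-> triangle g h (- fmap shift f);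
  triangle_fill : forall (X Y Z X' Y' Z' : C)
      (f : Mor X Y) (g : Mor Y Z) (h : Mor Z (shift X))
      (f' : Mor X' Y') (g' : Mor Y' Z') (h' : Mor Z' (shift X'))
      (a : Mor X X') (b : Mor Y Y'),
    triangle f g h -> triangle f' g' h' -> b \oc f = f' \oc a ->
    exists c : Mor Z Z', c \oc g = g' \oc b /\ fmap shift a \oc h = h' \oc c;
  (* the octahedral axiom *)
  triangle_octahedral : forall (X Y Z U V W : C)
      (f : Mor X Y) (p : Mor Y U) (d : Mor U (shift X))
      (g : Mor Y Z) (r : Mor Z W) (e : Mor W (shift Y))
      (q : Mor Z V) (k : Mor V (shift X)),
    triangle f p d -> triangle g r e -> triangle (g \oc f) q k ->
    exists (a : Mor U V) (b : Mor V W),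
      [/\ triangle a b (fmap shift p \oc e),
          a \oc p = q \oc g, k \oc a = d,
          b \oc q = r & e \oc b = fmap shift f \oc k]
}.

Arguments triangle {C} t {X Y Z} f g h.

Definition M_mono (C : add_category) (M : add_subcat C) (A B : C) (f : Mor A B) :
    Prop :=
  forall N : C, M N -> forall u : Mor A N, exists v : Mor B N, v \oc f = u.

Definition M_epi (C : add_category) (M : add_subcat C) (A B : C) (f : Mor A B) :
    Prop :=
  forall N : C, M N -> forall u : Mor N B, exists v : Mor N A, f \oc v = u.

Definition left_approx (C : add_category) (M : add_subcat C) (A B : C)
    (f : Mor A B) : Prop :=
  M B /\ M_mono M f.

Definition right_approx (C : add_category) (M : add_subcat C) (A B : C)
    (f : Mor A B) : Prop :=
  M A /\ M_epi M f.

Definition functorially_finite (C : add_category) (M Z : add_subcat C) : Prop :=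
  forall X : C, Z X ->
    (exists (N : C) (f : Mor X N), left_approx M f) /\
    (exists (N : C) (f : Mor N X), right_approx M f).

Definition factors_through (C : add_category) (M : add_subcat C) (X Y : C)
    (f : Mor X Y) : Prop :=
  exists (N : C) (u : Mor X N) (v : Mor N Y), M N /\ f = v \oc u.

Lemma mcomp0m (C : preadd_category) (X Y Z : C) (g : Mor Y Z) :
  g \oc (0 : Mor X Y) = 0.
Proof. by apply: (addIr (g \oc 0)); rewrite -mcompDl !add0r. Qed.

Lemma mcompm0 (C : preadd_category) (X Y Z : C) (f : Mor X Y) :
  (0 : Mor Y Z) \oc f = 0.
Proof. by apply: (addIr (0 \oc f)); rewrite -mcompDr !add0r. Qed.

Lemma mcompNl (C : preadd_category) (X Y Z : C) (f : Mor X Y) (g : Mor Y Z) :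
  g \oc (- f) = - (g \oc f).
Proof. by apply/eqP; rewrite -addr_eq0 -mcompDl addNr mcomp0m. Qed.

Lemma mcompNr (C : preadd_category) (X Y Z : C) (f : Mor X Y) (g : Mor Y Z) :
  (- g) \oc f = - (g \oc f).
Proof. by apply/eqP; rewrite -addr_eq0 -mcompDr addNr mcompm0. Qed.

Definition quot_pred (C : add_category) (M : add_subcat C) (X Y : C) :
    {pred Mor X Y} :=
  fun f => `[< factors_through M f >].

Arguments quot_pred {C} M X Y.

Lemma quot_predP (C : add_category) (M : add_subcat C) (X Y : C) (f : Mor X Y) :
  reflect (factors_through M f) (f \in quot_pred M X Y).
Proof. exact: asboolP. Qed.

Lemma quot_pred_closed (C : add_category) (M : add_subcat C) (X Y : C) :
  zmod_closed (quot_pred M X Y).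
Proof.
split=> [|f g /quot_predP[N [u [v [MN ->]]]] /quot_predP[N' [u' [v' [MN' ->]]]]];
    apply/quot_predP.
  have [O [MO _]] := subcat_zero M.
  by exists O, 0, 0; split=> //; rewrite mcomp0m.
have [S [MS [i1 [i2 [p1 [p2 [e11 e22 e21 e12 _]]]]]]] := subcat_biproduct MN MN'.
exists S, (i1 \oc u - i2 \oc u'), (v \oc p1 + v' \oc p2); split=> //.
rewrite mcompDl mcompNl !mcompDr -!mcompA.
rewrite (mcompA i1 p1) (mcompA i1 p2) (mcompA i2 p1) (mcompA i2 p2).
by rewrite e11 e22 e21 e12 !mcomp1m !(mcomp0m, mcompm0) addr0 add0r.
Qed.

HB.instance Definition _ (C : add_category) (M : add_subcat C) (X Y : C) :=
  GRing.isZmodClosed.Build (Mor X Y) (quot_pred M X Y) (quot_pred_closed M X Y).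

Lemma quot_predMl (C : add_category) (M : add_subcat C) (X Y Z : C)
    (f : Mor X Y) (g : Mor Y Z) :
  f \in quot_pred M X Y -> g \oc f \in quot_pred M X Z.
Proof.
move=> /quot_predP[N [u [v [MN ->]]]]; apply/quot_predP.
by exists N, u, (g \oc v); rewrite mcompA.
Qed.

Lemma quot_predMr (C : add_category) (M : add_subcat C) (X Y Z : C)
    (f : Mor X Y) (g : Mor Y Z) :
  g \in quot_pred M Y Z -> g \oc f \in quot_pred M X Z.
Proof.
move=> /quot_predP[N [u [v [MN ->]]]]; apply/quot_predP.
by exists N, (u \oc f), v; rewrite mcompA.
Qed.

(* Hom(X, Y) / M(X, Y) *)
Definition quot_hom (C : add_category) (M : add_subcat C) (X Y : C) : zmodType :=
  Quotient.quot (quot_pred M X Y).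

Definition quot_class (C : add_category) (M : add_subcat C) (X Y : C)
    (f : Mor X Y) : quot_hom M X Y :=
  (\pi_(Quotient.quot (quot_pred M X Y)) f)%qT.

Lemma quot_classP (C : add_category) (M : add_subcat C) (X Y : C)
    (f g : Mor X Y) :
  quot_class M f = quot_class M g <-> factors_through M (f - g).
Proof.
rewrite /quot_class; split=> [/eqP|/quot_predP].
  by rewrite -Quotient.idealrBE => /quot_predP.
by rewrite Quotient.idealrBE => /eqP.
Qed.

Definition quot_repr (C : add_category) (M : add_subcat C) (X Y : C)
    (f : quot_hom M X Y) : Mor X Y :=
  repr (f : Quotient.quot (quot_pred M X Y)).

Lemma quot_reprK (C : add_category) (M : add_subcat C) (X Y : C)
    (f : quot_hom M X Y) :
  quot_class M (quot_repr f) = f.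
Proof. exact: reprK. Qed.

Lemma quot_classD (C : add_category) (M : add_subcat C) (X Y : C)
    (f g : Mor X Y) :
  quot_class M (f + g) = quot_class M f + quot_class M g.
Proof. exact: (Quotient.pi_add (quot_pred M X Y) f g). Qed.

Lemma quot_class0 (C : add_category) (M : add_subcat C) (X Y : C) :
  quot_class M (0 : Mor X Y) = 0.
Proof. by apply: (addIr (quot_class M 0)); rewrite -quot_classD !add0r. Qed.

Definition quot_comp (C : add_category) (M : add_subcat C) (X Y Z : C)
    (f : quot_hom M X Y) (g : quot_hom M Y Z) : quot_hom M X Z :=
  quot_class M (quot_repr g \oc quot_repr f).

Lemma quot_compE (C : add_category) (M : add_subcat C) (X Y Z : C)
    (f : Mor X Y) (g : Mor Y Z) :
  quot_comp (quot_class M f) (quot_class M g) = quot_class M (g \oc f).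
Proof.
apply/(quot_classP M)/quot_predP.
set f' := quot_repr _; set g' := quot_repr _.
have /quot_classP/quot_predP ef : quot_class M f' = quot_class M f.
  exact: quot_reprK.
have /quot_classP/quot_predP eg : quot_class M g' = quot_class M g.
  exact: quot_reprK.
have -> : g' \oc f' - g \oc f = g' \oc (f' - f) + (g' - g) \oc f.
  by rewrite mcompDl mcompDr mcompNl mcompNr addrA subrK.
by apply: rpredD; [apply: quot_predMl|apply: quot_predMr].
Qed.

Lemma quot_comp1m (C : add_category) (M : add_subcat C) (X Y : C)
    (f : quot_hom M X Y) :
  quot_comp (quot_class M (idm X)) f = f.
Proof. by rewrite -[f]quot_reprK quot_compE mcomp1m. Qed.

Lemma quot_compm1 (C : add_category) (M : add_subcat C) (X Y : C)
    (f : quot_hom M X Y) :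
  quot_comp f (quot_class M (idm Y)) = f.
Proof. by rewrite -[f]quot_reprK quot_compE mcompm1. Qed.

Lemma quot_compA (C : add_category) (M : add_subcat C) (W X Y Z : C)
    (f : quot_hom M W X) (g : quot_hom M X Y) (h : quot_hom M Y Z) :
  quot_comp f (quot_comp g h) = quot_comp (quot_comp f g) h.
Proof.
by rewrite -[f]quot_reprK -[g]quot_reprK -[h]quot_reprK !quot_compE mcompA.
Qed.

Lemma quot_compDl (C : add_category) (M : add_subcat C) (X Y Z : C)
    (f f' : quot_hom M X Y) (g : quot_hom M Y Z) :
  quot_comp (f + f') g = quot_comp f g + quot_comp f' g.
Proof.
rewrite -[f]quot_reprK -[f']quot_reprK -[g]quot_reprK.
by rewrite -quot_classD !quot_compE mcompDl quot_classD.
Qed.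

Lemma quot_compDr (C : add_category) (M : add_subcat C) (X Y Z : C)
    (f : quot_hom M X Y) (g g' : quot_hom M Y Z) :
  quot_comp f (g + g') = quot_comp f g + quot_comp f g'.
Proof.
rewrite -[f]quot_reprK -[g]quot_reprK -[g']quot_reprK.
by rewrite -quot_classD !quot_compE mcompDr quot_classD.
Qed.

Definition quot_preadd_category (C : add_category) (Z M : add_subcat C) :
    preadd_category :=
  @PreaddCategory {X : C | Z X}
    (fun X Y => quot_hom M (sval X) (sval Y))
    (fun X => quot_class M (idm (sval X)))
    (fun X Y W f g => quot_comp f g)
    (fun X Y f => quot_comp1m f)
    (fun X Y f => quot_compm1 f)
    (fun V X Y W f g h => quot_compA f g h)
    (fun X Y W f f' g => quot_compDl f f' g)
    (fun X Y W f g g' => quot_compDr f g g').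

Lemma quot_has_zero_ob (C : add_category) (Z M : add_subcat C) :
  exists O : quot_preadd_category Z M, is_zero_ob O.
Proof.
have [O [ZO O0]] := subcat_zero Z.
exists (exist _ O ZO : quot_preadd_category Z M) => -[X ZX]; split=> f /=.
  by rewrite -[f]quot_reprK [quot_repr f](proj1 (O0 X)) quot_class0.
by rewrite -[f]quot_reprK [quot_repr f](proj2 (O0 X)) quot_class0.
Qed.

Lemma quot_has_biproduct (C : add_category) (Z M : add_subcat C)
    (X Y : quot_preadd_category Z M) :
  exists S : quot_preadd_category Z M, is_biproduct X Y S.
Proof.
case: X Y => [X ZX] [Y ZY].
have [S [ZS [i1 [i2 [p1 [p2 [e11 e22 e21 e12 e]]]]]]] := subcat_biproduct ZX ZY.
exists (exist _ S ZS : quot_preadd_category Z M).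
exists (quot_class M i1), (quot_class M i2), (quot_class M p1), (quot_class M p2).
by rewrite /= !quot_compE e11 e22 e21 e12 !quot_class0 -quot_classD e.
Qed.

(* Z/[M]. Since Z is full, a morphism of Z factors in Z through an object of
   M, for M contained in Z, exactly when it does so in C. *)
Definition quot_cat (C : add_category) (Z M : add_subcat C) : add_category :=
  @AddCategory (quot_preadd_category Z M) (@quot_has_zero_ob C Z M)
    (@quot_has_biproduct C Z M).

(* Main.v *)
Require Import Defs.
From mathcomp Require Import all_boot ssralg boolp.

Set Implicit Arguments.
Unset Strict Implicit.
Unset Printing Implicit Defensive.

Import GRing.Theory.

Local Open Scope ring_scope.

(** In the quotient Z/[M] every object of M becomes zero, so for a triangle
    X -> N -> Y -> X[1] of C that starts with a left M-approximation of X, the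
    object Y plays the role of a cone of X -> 0, that is, of the suspension of
    X. By the hypothesis on cones Y lies in Z, and it is the new shift ΣX; the
    argument is the one that makes the stable category of a Frobenius category
    triangulated, with M in the role of the projective-injectives.

    The bookkeeping is carried by the connecting morphism c_X : ΣX -> X[1] of
    this triangle. The morphisms t : W -> X[1] that factor through c_X are
    exactly the ghosts, those killed by y[1] for every y from X to an object of
    M ([suspends_ghost], [ghost_lift]), and the factorization is unique modulo
    [M] ([conn_inj]). Hence Σf is the solution s of c_Y s = f[1] c_X, a
    characterization from which functoriality, additivity and independence of
    the chosen approximations follow by computing in C. That Σ is full and
    faithful rests on the other half of the hypothesis on cones, by which c_X
    kills the morphisms from objects of M to ΣX ([conn_kills]). That Σ is
    essentially surjective comes from the hypothesis on cocones: complete a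
    right M-approximation N -> Y to a triangle B -> N -> Y -> B[1]; then Y is a
    suspension of B.

    In a triangle X -a-> Y -b-> W -h-> X[1] of C, the morphism a is an
    M-monomorphism if and only if h is a ghost ([M_mono_ghost]), that is,
    h = c_X d for some d : W -> ΣX. The triangles of the quotient are the
    sequences isomorphic to such X -a-> Y -b-> W -d-> ΣX. Every morphism of
    the quotient is isomorphic to the class of an M-monomorphism
    ([M_mono_replacement]), squares that commute modulo [M] can be corrected so
    as to commute in C ([standard_fill]), and the octahedral axiom for a pair
    of M-monomorphisms is inherited from C ([standard_octahedral]). Rotation is
    the one axiom that requires a construction ([standard_rot]).

    It is enough to verify the axioms in a reduced form, stated here as
    [weak_triangulation]: triangles are rotated forward only, and one octahedron
    is produced for each composable pair. The general form follows formally
    ([triangulation_of_weak]). *)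

(** * Isomorphisms and additive functors *)

Section Isomorphisms.

Variable C : preadd_category.
Implicit Types X Y : C.

Lemma is_iso_id X : is_iso (idm X).
Proof. by exists (idm X); rewrite mcomp1m. Qed.

Lemma is_iso_comp X Y W (f : Mor X Y) (g : Mor Y W) :
  is_iso f -> is_iso g -> is_iso (g \oc f).
Proof.
move=> [f' [f'f ff']] [g' [g'g gg']]; exists (f' \oc g'); split.
  by rewrite mcompA -[g' \oc _]mcompA g'g mcompm1 f'f.
by rewrite mcompA -[f \oc _]mcompA ff' mcompm1 gg'.
Qed.

(** Yoneda: an isomorphism is detected by the functors represented by the
    objects of the category. *)
Lemma is_iso_yoneda X Y (f : Mor X Y) :
  (forall W (v : Mor W Y), exists u, f \oc u = v) ->
  (forall W (u : Mor W X), f \oc u = 0 -> u = 0) ->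
  is_iso f.
Proof.
move=> surj inj; have [g fg] := surj Y (idm Y).
exists g; split=> //; apply/subr0_eq/inj.
by rewrite mcompDl mcompNl -mcompA fg mcomp1m mcompm1 subrr.
Qed.

Lemma is_iso_mono X Y (f : Mor X Y) : is_iso f ->
  forall W (u v : Mor W X), f \oc u = f \oc v -> u = v.
Proof.
move=> [f' [f'f _]] W u v /(congr1 (mcomp^~ f')).
by rewrite -!mcompA f'f !mcompm1.
Qed.

Lemma is_iso_epi X Y (f : Mor X Y) : is_iso f ->
  forall W (u v : Mor Y W), u \oc f = v \oc f -> u = v.
Proof.
move=> [f' [_ ff']] W u v /(congr1 (mcomp f')).
by rewrite !mcompA ff' !mcomp1m.
Qed.

End Isomorphisms.

Section AdditiveFunctors.

Variables (C D : preadd_category) (F : add_functor C D).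

Definition faithful := forall X Y, injective (@fmap C D F X Y).

Definition full :=
  forall X Y (g : Mor (F X) (F Y)), exists f : Mor X Y, fmap F f = g.

Definition essentially_surjective :=
  forall Y : D, exists (X : C) (e : Mor (F X) Y), is_iso e.

Lemma fmap0 X Y : fmap F (0 : Mor X Y) = 0.
Proof. by apply: (addIr (fmap F 0)); rewrite -fmapD !add0r. Qed.

Lemma fmapN X Y (f : Mor X Y) : fmap F (- f) = - fmap F f.
Proof. by apply/eqP; rewrite -addr_eq0 -fmapD addNr fmap0. Qed.

Lemma is_iso_fmap X Y (f : Mor X Y) : is_iso f -> is_iso (fmap F f).
Proof.
by case=> f' [f'f ff']; exists (fmap F f'); rewrite -!fmap_comp f'f ff' !fmap1.
Qed.

Lemma fmap_zero_ob O : is_zero_ob O -> is_zero_ob (F O).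
Proof.
move=> O0; have id0 : idm (F O) = 0 by rewrite -fmap1 ((O0 O).1 (idm O)) fmap0.
move=> X; split=> f.
  by rewrite -[f]mcomp1m id0 mcomp0m.
by rewrite -[f]mcompm1 id0 mcompm0.
Qed.

Lemma is_iso_reflect X Y (f : Mor X Y) :
  full -> faithful -> is_iso (fmap F f) -> is_iso f.
Proof.
move=> Ffull Ffaith [g' [g'f fg']]; have [g gE] := Ffull _ _ g'.
by exists g; split; apply: Ffaith; rewrite fmap_comp gE fmap1.
Qed.

(** Preimages of the objects and morphisms of D are chosen; faithfulness makes
    the choice functorial. *)
Lemma is_equivalence_ff :
  full -> faithful -> essentially_surjective -> is_equivalence F.
Proof.
move=> Ffull Ffaith Fsurj.
pose G0 Y : C := sval (cid (Fsurj Y)).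
pose e Y : Mor (F (G0 Y)) Y := sval (cid (svalP (cid (Fsurj Y)))).
have e_iso Y : is_iso (e Y) := svalP (cid (svalP (cid (Fsurj Y)))).
pose e' Y : Mor Y (F (G0 Y)) := sval (cid (e_iso Y)).
have e'e Y : e' Y \oc e Y = idm _ := proj1 (svalP (cid (e_iso Y))).
have ee' Y : e Y \oc e' Y = idm _ := proj2 (svalP (cid (e_iso Y))).
pose Gm Y Y' (g : Mor Y Y') := sval (cid (Ffull _ _ (e' Y' \oc g \oc e Y))).
have GmE Y Y' (g : Mor Y Y') : fmap F (Gm _ _ g) = e' Y' \oc g \oc e Y.
  exact: svalP (cid (Ffull _ _ (e' Y' \oc g \oc e Y))).
have Gm1 Y : Gm _ _ (idm Y) = idm _.
  by apply: Ffaith; rewrite GmE fmap1 mcomp1m e'e.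
have GmC Y Y' Y'' (g : Mor Y Y') (g' : Mor Y' Y'') :
    Gm _ _ (g' \oc g) = Gm _ _ g' \oc Gm _ _ g.
  apply: Ffaith; rewrite fmap_comp !GmE !mcompA.
  by rewrite -[e _ \oc (e' _ \oc _)]mcompA ee' mcompm1.
have GmD Y Y' (g g' : Mor Y Y') : Gm _ _ (g + g') = Gm _ _ g + Gm _ _ g'.
  by apply: Ffaith; rewrite fmapD !GmE mcompDl mcompDr.
pose G := AddFunctor Gm1 GmC GmD.
pose eta X : Mor X (G (F X)) := sval (cid (Ffull _ _ (e' (F X)))).
have etaE X : fmap F (eta X) = e' (F X).
  exact: svalP (cid (Ffull _ _ (e' (F X)))).
exists G, eta, e; split=> // [X|X X' f|Y Y' g].
- apply: is_iso_reflect => //; rewrite etaE.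
  by exists (e (F X)).
- apply: Ffaith; rewrite !fmap_comp !etaE /= GmE mcompA ee'.
  by rewrite mcomp1m.
- by rewrite /= GmE -!mcompA ee' mcompm1.
Qed.

Section Equivalence.

Hypothesis Fequiv : is_equivalence F.

Lemma equivalence_faithful : faithful.
Proof.
have [G [eta [_ [eta_iso _ etaN _]]]] := Fequiv.
move=> X Y f g fg; apply: (is_iso_mono (eta_iso Y)).
by rewrite !etaN fg.
Qed.

Lemma equivalence_full : full.
Proof.
have [G [eta [eps [eta_iso eps_iso etaN epsN]]]] := Fequiv.
move=> X Y g; have [e' [e'e ee']] := eta_iso Y.
exists (e' \oc fmap G g \oc eta X).
have Gfaith X1 Y1 (u v : Mor X1 Y1) : fmap G u = fmap G v -> u = v.
  by move=> uv; apply: (is_iso_epi (eps_iso X1)); rewrite !epsN uv.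
apply/Gfaith/(is_iso_epi (eta_iso X)); rewrite -etaN.
by rewrite mcompA -[eta Y \oc _]mcompA ee' mcompm1.
Qed.

Lemma equivalence_essentially_surjective : essentially_surjective.
Proof.
have [G [_ [eps [_ eps_iso _ _]]]] := Fequiv.
by move=> Y; exists (G Y), (eps Y).
Qed.

End Equivalence.

End AdditiveFunctors.

(** * Triangulations from a smaller set of axioms *)

(** The axioms of a triangulation with the shift required to be fully faithful
    and essentially surjective, with forward rotation only, and with an
    octahedron for some choice of the three cones. This is what a category
    whose triangles are defined as the sequences isomorphic to certain standard
    ones gives directly; see [triangulation_of_weak]. *)
Record weak_triangulation (C : add_category) := WeakTriangulation {
  wshift : add_functor C C;
  wtriangle : forall X Y Z : C,
    Mor X Y -> Mor Y Z -> Mor Z (wshift X) -> Prop;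
  wshift_full : full wshift;
  wshift_faithful : faithful wshift;
  wshift_essentially_surjective : essentially_surjective wshift;
  wtriangle_iso : forall (X Y Z X' Y' Z' : C)
      (f : Mor X Y) (g : Mor Y Z) (h : Mor Z (wshift X))
      (f' : Mor X' Y') (g' : Mor Y' Z') (h' : Mor Z' (wshift X'))
      (a : Mor X X') (b : Mor Y Y') (c : Mor Z Z'),
    is_iso a -> is_iso b -> is_iso c ->
    b \oc f = f' \oc a -> c \oc g = g' \oc b ->
    fmap wshift a \oc h = h' \oc c ->
    wtriangle f g h -> wtriangle f' g' h';
  wtriangle_id : forall X O : C, is_zero_ob O ->
    wtriangle (idm X) (0 : Mor X O) (0 : Mor O (wshift X));
  wtriangle_cone : forall (X Y : C) (f : Mor X Y),
    exists (Z : C) (g : Mor Y Z) (h : Mor Z (wshift X)), wtriangle f g h;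
  wtriangle_rot : forall (X Y Z : C)
      (f : Mor X Y) (g : Mor Y Z) (h : Mor Z (wshift X)),
    wtriangle f g h -> wtriangle g h (- fmap wshift f);
  wtriangle_fill : forall (X Y Z X' Y' Z' : C)
      (f : Mor X Y) (g : Mor Y Z) (h : Mor Z (wshift X))
      (f' : Mor X' Y') (g' : Mor Y' Z') (h' : Mor Z' (wshift X'))
      (a : Mor X X') (b : Mor Y Y'),
    wtriangle f g h -> wtriangle f' g' h' -> b \oc f = f' \oc a ->
    exists c : Mor Z Z', c \oc g = g' \oc b /\ fmap wshift a \oc h = h' \oc c;
  wtriangle_octahedral : forall (X Y Z : C) (f : Mor X Y) (g : Mor Y Z),
    exists (U V W : C)
      (p : Mor Y U) (d : Mor U (wshift X)) (r : Mor Z W) (e : Mor W (wshift Y))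
      (q : Mor Z V) (k : Mor V (wshift X)) (a : Mor U V) (b : Mor V W),
    [/\ wtriangle f p d, wtriangle g r e, wtriangle (g \oc f) q k
      & [/\ wtriangle a b (fmap wshift p \oc e),
          a \oc p = q \oc g, k \oc a = d,
          b \oc q = r & e \oc b = fmap wshift f \oc k]]
}.

Section WeakTriangulation.

Variables (C : add_category) (T : weak_triangulation C).
Notation S := (wshift T).

Lemma wtriangle_comp0 (X Y Z : C) (f : Mor X Y) (g : Mor Y Z)
    (h : Mor Z (S X)) :
  wtriangle f g h -> g \oc f = 0.
Proof.
move=> fgh.
have [O O0] := has_zero_ob C.
have /(wtriangle_fill (wtriangle_id T X O0) fgh)[c [<- _]] :
  f \oc idm X = f \oc idm X by [].
by rewrite mcomp0m.
Qed.

Lemma wtriangle_comp0_rot (X Y Z : C) (f : Mor X Y) (g : Mor Y Z)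
    (h : Mor Z (S X)) :
  wtriangle f g h -> h \oc g = 0.
Proof. by move=> /wtriangle_rot/wtriangle_comp0. Qed.

Lemma wtriangle_comp0_rot2 (X Y Z : C) (f : Mor X Y) (g : Mor Y Z)
    (h : Mor Z (S X)) :
  wtriangle f g h -> fmap S f \oc h = 0.
Proof.
move=> /wtriangle_rot/wtriangle_rot/wtriangle_comp0; rewrite mcompNr => /eqP.
by rewrite oppr_eq0 => /eqP.
Qed.

(** A morphism u : W -> Y killed by g is a map of triangles, up to rotation,
    from the triangle of idm W. *)
Lemma wtriangle_exact (X Y Z : C) (f : Mor X Y) (g : Mor Y Z)
    (h : Mor Z (S X)) W (u : Mor W Y) :
  wtriangle f g h -> g \oc u = 0 -> exists s : Mor W X, u = f \oc s.
Proof.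
move=> fgh gu0; have [O O0] := has_zero_ob C.
have gu : (0 : Mor O Z) \oc (0 : Mor W O) = g \oc u by rewrite gu0 mcompm0.
have [c [_]] := wtriangle_fill (wtriangle_rot (wtriangle_id T W O0))
  (wtriangle_rot fgh) gu.
have [s <-] := wshift_full c.
rewrite fmap1 mcompNl mcompNr mcomp1m -fmap_comp => /oppr_inj/wshift_faithful.
by exists s.
Qed.

Section Cones.

Variables (X Y Z : C) (f : Mor X Y) (g : Mor Y Z) (h : Mor Z (S X)).
Hypothesis fgh : wtriangle f g h.

Lemma wtriangle_exact2 W (u : Mor W Z) :
  h \oc u = 0 -> exists s : Mor W Y, u = g \oc s.
Proof. exact: wtriangle_exact (wtriangle_rot fgh). Qed.

Lemma wtriangle_exact3 W (u : Mor W (S X)) :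
  fmap S f \oc u = 0 -> exists s : Mor W Z, u = h \oc s.
Proof.
move=> fu0; apply: (wtriangle_exact (wtriangle_rot (wtriangle_rot fgh))).
by rewrite mcompNr fu0 oppr0.
Qed.

(** The part of the five lemma that gives the uniqueness of cones; it only
    involves covariant exactness. *)
Lemma wtriangle_five Z' (g' : Mor Y Z') (h' : Mor Z' (S X)) (c : Mor Z Z') :
  wtriangle f g' h' -> c \oc g = g' -> h' \oc c = h -> is_iso c.
Proof.
move=> fgh' cg hc; apply: is_iso_yoneda => [W v|W u cu0].
  have [s hs] : exists s : Mor W Z, h' \oc v = h \oc s.
    apply: wtriangle_exact3; rewrite -mcompA.
    by rewrite (wtriangle_comp0_rot2 fgh') mcompm0.
  have [t vt] : exists t : Mor W Y, v - c \oc s = g' \oc t.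
    apply: (wtriangle_exact (wtriangle_rot fgh')).
    by rewrite mcompDl mcompNl hs -mcompA hc subrr.
  exists (s + g \oc t); rewrite mcompDl -mcompA cg -vt.
  by rewrite addrC subrK.
have [t ut] : exists t : Mor W Y, u = g \oc t.
  by apply: wtriangle_exact2; rewrite -hc mcompA cu0 mcomp0m.
have [s ts] : exists s : Mor W X, t = f \oc s.
  by apply: (wtriangle_exact fgh'); rewrite -cg mcompA -ut.
by rewrite ut ts -mcompA (wtriangle_comp0 fgh) mcompm0.
Qed.

Lemma wtriangle_cone_unique Z' (g' : Mor Y Z') (h' : Mor Z' (S X)) :
  wtriangle f g' h' -> exists (c : Mor Z Z') (c' : Mor Z' Z),
  [/\ c' \oc c = idm Z, c \oc c' = idm Z',
      [/\ c \oc g = g', h' \oc c = h, c' \oc g' = g & h \oc c' = h']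
    & is_iso c'].
Proof.
move=> fgh'.
have ff : idm Y \oc f = f \oc idm X by rewrite mcomp1m mcompm1.
have [c []] := wtriangle_fill fgh fgh' ff.
rewrite fmap1 mcompm1 mcomp1m => cg /esym hc.
have [c' [c'c cc']] := wtriangle_five fgh' cg hc.
exists c, c'; split=> //; last by exists c.
split=> //; first by rewrite -cg -mcompA c'c mcompm1.
by rewrite -hc mcompA cc' mcomp1m.
Qed.

End Cones.

(** Rotate (g, h, -f[1]) forward twice more and the cone of f three times: the
    two results share their first morphism, hence differ by an isomorphism of
    third objects, which is the shift of an isomorphism because the shift is
    fully faithful. *)
Lemma wtriangle_unrot X Y Z (f : Mor X Y) (g : Mor Y Z) (h : Mor Z (S X)) :
  wtriangle g h (- fmap S f) -> wtriangle f g h.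
Proof.
move=> /wtriangle_rot/wtriangle_rot rot3.
have [Z' [g' [h' fgh']]] := wtriangle_cone T f.
have rot3' := wtriangle_rot (wtriangle_rot (wtriangle_rot fgh')).
have [c [c' [c'c cc' [cg hc c'g hc'] c'iso]]] :=
  wtriangle_cone_unique rot3' rot3.
have [d dE] := wshift_full c.
have d_iso : is_iso d.
  apply: is_iso_reflect; first exact: wshift_full.
    exact: wshift_faithful.
  by rewrite dE; exists c'.
have dg : d \oc g' = g.
  apply: (@wshift_faithful _ T); rewrite fmap_comp dE.
  by apply: oppr_inj; rewrite -mcompNl cg.
have hd : h \oc d = h'.
  apply: (@wshift_faithful _ T); rewrite fmap_comp dE.
  by apply: oppr_inj; rewrite -mcompNr hc.
apply: (wtriangle_iso (is_iso_id X) (is_iso_id Y) d_iso _ _ _ fgh').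
- by rewrite mcompm1 mcomp1m.
- by rewrite mcomp1m.
- by rewrite fmap1 mcompm1 hd.
Qed.

(** An octahedron on one choice of cones carries over to any other, since two
    cones of a morphism are isomorphic compatibly with their structure maps. *)
Lemma wtriangle_octahedral_all (X Y Z U V W : C)
    (f : Mor X Y) (p : Mor Y U) (d : Mor U (S X))
    (g : Mor Y Z) (r : Mor Z W) (e : Mor W (S Y))
    (q : Mor Z V) (k : Mor V (S X)) :
  wtriangle f p d -> wtriangle g r e -> wtriangle (g \oc f) q k ->
  exists (a : Mor U V) (b : Mor V W),
    [/\ wtriangle a b (fmap S p \oc e),
        a \oc p = q \oc g, k \oc a = d,
        b \oc q = r & e \oc b = fmap S f \oc k].
Proof.
move=> Tf Tg Tgf.
have [U0 [V0 [W0 [p0 [d0 [r0 [e0 [q0 [k0 [a [b [Tf0 Tg0 Tgf0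
  [Tab ap ka bq eb]]]]]]]]]]]]] := wtriangle_octahedral T f g.
have [u [u' [u'u uu' [up du u'p du'] u'iso]]] := wtriangle_cone_unique Tf Tf0.
have [v [v' [v'v vv' [vq kv v'q kv'] v'iso]]] := wtriangle_cone_unique Tgf Tgf0.
have [w [w' [w'w ww' [wr ew w'r ew'] w'iso]]] := wtriangle_cone_unique Tg Tg0.
exists (v' \oc a \oc u), (w' \oc b \oc v); split.
- apply: (wtriangle_iso u'iso v'iso w'iso _ _ _ Tab).
  + by rewrite mcompA uu' mcomp1m.
  + by rewrite mcompA vv' mcomp1m.
  + by rewrite -mcompA -fmap_comp u'p mcompA ew'.
- by rewrite mcompA up mcompA ap -mcompA v'q.
- by rewrite -!mcompA kv' ka du.
- by rewrite mcompA vq mcompA bq w'r.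
- by rewrite -!mcompA ew' eb mcompA kv.
Qed.

Definition triangulation_of_weak : triangulation C.
Proof.
apply: (@Triangulation C S (@wtriangle C T)).
- apply: is_equivalence_ff; first exact: wshift_full.
    exact: wshift_faithful.
  exact: wshift_essentially_surjective.
- exact: wtriangle_iso.
- exact: wtriangle_id.
- exact: wtriangle_cone.
- by move=> X Y Z f g h; split; [apply: wtriangle_rot|apply: wtriangle_unrot].
- exact: wtriangle_fill.
- exact: wtriangle_octahedral_all.
Defined.

End WeakTriangulation.

(** * Exactness in a triangulated category *)

Section Triangulated.

Variables (C : add_category) (T : triangulation C).
Notation S := (shift T).

(** Makes the exactness properties of weak triangulations available in C. *)
Definition weak_of_triangulation : weak_triangulation C.
Proof.
apply: (@WeakTriangulation C S (@triangle C T)).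
- exact/equivalence_full/shift_equivalence.
- exact/equivalence_faithful/shift_equivalence.
- exact/equivalence_essentially_surjective/shift_equivalence.
- exact: triangle_iso.
- exact: triangle_id.
- exact: triangle_cone.
- by move=> X Y Z f g h /triangle_rot.
- exact: triangle_fill.
- move=> X Y Z f g.
  have [U [p [d Tf]]] := triangle_cone T f.
  have [W [r [e Tg]]] := triangle_cone T g.
  have [V [q [k Tgf]]] := triangle_cone T (g \oc f).
  have [a [b Tab]] := triangle_octahedral Tf Tg Tgf.
  by exists U, V, W, p, d, r, e, q, k, a, b.
Defined.

Section Exactness.

Variables (X Y Z : C) (f : Mor X Y) (g : Mor Y Z) (h : Mor Z (S X)).
Hypothesis fgh : triangle T f g h.

Lemma triangle_comp0 : g \oc f = 0.
Proof. exact: (@wtriangle_comp0 _ weak_of_triangulation _ _ _ _ _ _ fgh). Qed.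

Lemma triangle_comp0_rot : h \oc g = 0.
Proof.
exact: (@wtriangle_comp0_rot _ weak_of_triangulation _ _ _ _ _ _ fgh).
Qed.

Lemma triangle_comp0_rot2 : fmap S f \oc h = 0.
Proof.
exact: (@wtriangle_comp0_rot2 _ weak_of_triangulation _ _ _ _ _ _ fgh).
Qed.

Lemma triangle_exact2 W (u : Mor W Z) :
  h \oc u = 0 -> exists s : Mor W Y, u = g \oc s.
Proof. exact: (@wtriangle_exact2 _ weak_of_triangulation _ _ _ _ _ _ fgh). Qed.

Lemma triangle_exact3 W (u : Mor W (S X)) :
  fmap S f \oc u = 0 -> exists s : Mor W Z, u = h \oc s.
Proof. exact: (@wtriangle_exact3 _ weak_of_triangulation _ _ _ _ _ _ fgh). Qed.

(** A morphism that kills f is a map to the triangle O -> W = W -> O[1]. *)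
Lemma triangle_coexact W (u : Mor Y W) :
  u \oc f = 0 -> exists s : Mor Z W, u = s \oc g.
Proof.
move=> uf0; have [O O0] := has_zero_ob C.
have TW : triangle T (0 : Mor O W) (idm W) (0 : Mor W (S O)).
  apply/triangle_rot; rewrite fmap0 oppr0.
  exact/triangle_id/fmap_zero_ob.
have uf : u \oc f = (0 : Mor O W) \oc (0 : Mor X O) by rewrite uf0 mcomp0m.
by have [s [+ _]] := triangle_fill fgh TW uf; rewrite mcompm1 => <-; exists s.
Qed.

End Exactness.

Lemma triangle_coexact2 (X Y Z : C) (f : Mor X Y) (g : Mor Y Z)
    (h : Mor Z (S X)) W (u : Mor Z W) :
  triangle T f g h -> u \oc g = 0 -> exists s : Mor (S X) W, u = s \oc h.
Proof. by move=> /triangle_rot/triangle_coexact; apply. Qed.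

Lemma triangle_coexact3 (X Y Z : C) (f : Mor X Y) (g : Mor Y Z)
    (h : Mor Z (S X)) W (u : Mor (S X) W) :
  triangle T f g h -> u \oc h = 0 -> exists s : Mor (S Y) W, u = s \oc fmap S f.
Proof.
move=> /triangle_rot Tg uh0; have [s ->] := triangle_coexact2 Tg uh0.
by exists (- s); rewrite mcompNl mcompNr.
Qed.

(** Rotate the cone of g backward: its last object is a shift X[1], up to an
    isomorphism e. *)
Lemma triangle_cocone (Y Z : C) (g : Mor Y Z) :
  exists (X : C) (f : Mor X Y) (h : Mor Z (S X)), triangle T f g h.
Proof.
have [K [k [l Tg]]] := triangle_cone T g.
have [X [e [e' [e'e ee']]]] :=
  equivalence_essentially_surjective (shift_equivalence T) K.
have [f fE] := equivalence_full (shift_equivalence T) (l \oc e).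
exists X, (- f), (e' \oc k); apply/triangle_rot; rewrite fmapN opprK fE.
apply: (triangle_iso (is_iso_id Y) (is_iso_id Z) (c := e') _ _ _ _ Tg).
- by exists e.
- by rewrite mcompm1 mcomp1m.
- by rewrite mcomp1m.
- by rewrite fmap1 mcompm1 mcompA ee' mcomp1m.
Qed.

(** * Ghosts and suspensions *)

Variable M : add_subcat C.

(** For a triangle X -f-> Y -g-> W -h-> X[1], being an M-monomorphism is a
    property of h, independent of f and g; see [M_mono_ghost]. *)
Definition ghost (X W : C) (t : Mor W (S X)) :=
  forall N, M N -> forall y : Mor X N, fmap S y \oc t = 0.

(** The obstruction to extending y : X -> N along f is y[1] h: it vanishes if
    and only if y[1] factors through f[1], by exactness at X[1]. *)
Lemma M_mono_ghost X Y W (f : Mor X Y) (g : Mor Y W) (h : Mor W (S X)) :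
  triangle T f g h -> (M_mono M f <-> ghost h).
Proof.
move=> fgh; split=> [fM N MN y|hM N MN y].
  have [v <-] := fM N MN y.
  by rewrite fmap_comp mcompA (triangle_comp0_rot2 fgh) mcomp0m.
have [s] := triangle_coexact3 fgh (hM N MN y).
have [s0 <-] := equivalence_full (shift_equivalence T) s.
rewrite -fmap_comp => /(equivalence_faithful (shift_equivalence T)) ->.
by exists s0.
Qed.

Lemma ghost_comp X W W' (t : Mor W (S X)) (s : Mor W' W) :
  ghost t -> ghost (t \oc s).
Proof. by move=> tM N MN y; rewrite -mcompA (tM N MN) mcompm0. Qed.

Lemma ghost_fmap X X' W (t : Mor W (S X)) (x : Mor X X') :
  ghost t -> ghost (fmap S x \oc t).
Proof. by move=> tM N MN y; rewrite -mcompA -fmap_comp; apply: tM. Qed.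

Lemma M_epi_comp0 X Y W (f : Mor X Y) (g : Mor Y W) (h : Mor W (S X)) N
    (y : Mor N W) :
  triangle T f g h -> M_epi M g -> M N -> h \oc y = 0.
Proof.
move=> fgh gM MN; have [v <-] := gM N MN y.
by rewrite -mcompA (triangle_comp0_rot fgh) mcompm0.
Qed.

(** c is the last morphism of a triangle X -> N -> Y -> X[1] whose first
    morphism is a left M-approximation. *)
Definition suspends (X Y : C) (c : Mor Y (S X)) :=
  exists (N : C) (a : Mor X N) (b : Mor N Y),
    left_approx M a /\ triangle T a b c.

Lemma suspends_ghost X Y (c : Mor Y (S X)) : suspends c -> ghost c.
Proof. by move=> [N [a [b [[_ aM] /M_mono_ghost[+ _]]]]]; apply. Qed.

Lemma ghost_lift X Y W (c : Mor Y (S X)) (t : Mor W (S X)) :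
  suspends c -> ghost t -> exists d : Mor W Y, c \oc d = t.
Proof.
move=> [N [a [b [[MN aM] abc]]]] /(_ N MN a) at0.
by have [d ->] := triangle_exact3 abc at0; exists d.
Qed.

Lemma suspends_factors X Y W (c : Mor Y (S X)) (t : Mor W Y) :
  suspends c -> c \oc t = 0 -> factors_through M t.
Proof.
move=> [N [a [b [[MN aM] abc]]]] /(triangle_exact2 abc)[s ->].
by exists N, s, b.
Qed.

End Triangulated.

(** * The quotient category *)

Section Quotient.

Variables (C : add_category) (T : triangulation C) (M Z : add_subcat C).
Hypothesis MZ : forall X : C, M X -> Z X.
Hypothesis M_finite : functorially_finite M Z.
Hypothesis Z_cone : forall (Z1 Z2 K : C)
  (f : Mor Z1 Z2) (g : Mor Z2 K) (h : Mor K (shift T Z1)),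
  Z Z1 -> Z Z2 -> M_mono M f -> triangle T f g h -> Z K /\ M_epi M g.
Hypothesis Z_cocone : forall (B Z2 Z3 : C)
  (f : Mor B Z2) (g : Mor Z2 Z3) (h : Mor Z3 (shift T B)),
  Z Z2 -> Z Z3 -> M_epi M g -> triangle T f g h -> Z B /\ M_mono M f.

Notation S := (shift T).
Notation D := (quot_cat Z M).

Definition qob (X : D) : C := sval X.

Definition qmor (X Y : D) (f : Mor (qob X) (qob Y)) : Mor X Y := quot_class M f.

Lemma qmor_comp X Y W (f : Mor (qob X) (qob Y)) (g : Mor (qob Y) (qob W)) :
  qmor (g \oc f) = qmor g \oc qmor f.
Proof. by rewrite /qmor /= quot_compE. Qed.

Lemma qmor_id (X : D) : qmor (idm (qob X)) = idm X.
Proof. by []. Qed.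

Lemma qmorD X Y (f g : Mor (qob X) (qob Y)) : qmor (f + g) = qmor f + qmor g.
Proof. exact: quot_classD. Qed.

Lemma qmorN X Y (f : Mor (qob X) (qob Y)) : qmor (- f) = - qmor f.
Proof.
apply/eqP; rewrite -addr_eq0 -qmorD addNr; apply/eqP/quot_class0.
Qed.

Lemma qmor_onto X Y (F : Mor X Y) : exists f, F = qmor f.
Proof. by exists (quot_repr F); rewrite /qmor quot_reprK. Qed.

Lemma qmor_eq X Y (f g : Mor (qob X) (qob Y)) :
  qmor f = qmor g <-> factors_through M (f - g).
Proof. exact: quot_classP. Qed.

(** ** The suspension *)

Lemma suspension_exists (X : D) :
  exists (Y : D) (c : Mor (qob Y) (S (qob X))), suspends M c.
Proof.
have [[N [a aM]] _] := M_finite (svalP X).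
have [Y [b [c abc]]] := triangle_cone T a.
have [ZY _] := Z_cone (svalP X) (MZ aM.1) aM.2 abc.
by exists (exist _ Y ZY), c; exists N, a, b.
Qed.

Definition susp (X : D) : D := sval (cid (suspension_exists X)).

Definition conn (X : D) : Mor (qob (susp X)) (S (qob X)) :=
  sval (cid (svalP (cid (suspension_exists X)))).

Lemma conn_suspends X : suspends M (conn X).
Proof. exact: svalP (cid (svalP (cid (suspension_exists X)))). Qed.

Lemma conn_lift X W (t : Mor W (S (qob X))) :
  ghost M t -> exists d, conn X \oc d = t.
Proof. exact/ghost_lift/conn_suspends. Qed.

Lemma conn_inj X W (s t : Mor (qob W) (qob (susp X))) :
  conn X \oc s = conn X \oc t -> qmor s = qmor t.
Proof.
move=> st; apply/qmor_eq/(suspends_factors (conn_suspends X)).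
by rewrite mcompDl mcompNl st subrr.
Qed.

(** The middle morphism of the triangle that defines the suspension is an
    M-epimorphism, by the hypothesis on cones, so y factors through it. *)
Lemma conn_kills X N (y : Mor N (qob (susp X))) : M N -> conn X \oc y = 0.
Proof.
move=> MN; have [N' [a [b [[MN' aM] abc]]]] := conn_suspends X.
by apply: (M_epi_comp0 y abc _ MN); apply: (Z_cone (svalP X) (MZ MN') aM abc).2.
Qed.

Lemma conn_comp_eq X W (s t : Mor (qob W) (qob (susp X))) :
  qmor s = qmor t -> conn X \oc s = conn X \oc t.
Proof.
move=> /qmor_eq[N [u [v [MN st]]]]; apply: subr0_eq.
by rewrite -mcompNl -mcompDl st -mcompA conn_kills // mcompm0.
Qed.

Lemma fmap_conn_eq X Y (f g : Mor (qob X) (qob Y)) :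
  qmor f = qmor g -> fmap S f \oc conn X = fmap S g \oc conn X.
Proof.
move=> /qmor_eq[N [u [v [MN fg]]]]; apply: subr0_eq.
rewrite -mcompNr -mcompDr -fmapN -fmapD fg fmap_comp mcompA.
by rewrite (suspends_ghost (conn_suspends X) MN) mcomp0m.
Qed.

(** Up to [M], the suspension of f is the morphism s that satisfies
    c_Y s = f[1] c_X for the connecting morphisms c_X and c_Y. *)
Lemma susp_lift (X Y : D) (f : Mor (qob X) (qob Y)) :
  exists s, conn Y \oc s = fmap S f \oc conn X.
Proof. exact/conn_lift/ghost_fmap/suspends_ghost/conn_suspends. Qed.

Definition susp_map (X Y : D) (F : Mor X Y) : Mor (susp X) (susp Y) :=
  qmor (sval (cid (susp_lift (quot_repr F)))).

Lemma susp_mapE X Y (f : Mor (qob X) (qob Y)) s :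
  conn Y \oc s = fmap S f \oc conn X -> susp_map (qmor f) = qmor s.
Proof.
move=> sf; rewrite /susp_map; case: cid => s' /= s'f.
apply: conn_inj; rewrite sf s'f; apply: fmap_conn_eq.
by rewrite /qmor quot_reprK.
Qed.

Lemma susp_map1 X : susp_map (idm X) = idm (susp X).
Proof.
by rewrite -qmor_id (susp_mapE (s := idm _)) // fmap1 mcompm1 mcomp1m.
Qed.

Lemma susp_map_comp X Y W (F : Mor X Y) (G : Mor Y W) :
  susp_map (G \oc F) = susp_map G \oc susp_map F.
Proof.
have [[f ->] [g ->]] := (qmor_onto F, qmor_onto G).
have [[s sf] [t tg]] := (susp_lift f, susp_lift g).
rewrite -qmor_comp (susp_mapE sf) (susp_mapE tg) -qmor_comp.
by apply: susp_mapE; rewrite -mcompA tg mcompA sf -mcompA fmap_comp.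
Qed.

Lemma susp_mapD X Y (F G : Mor X Y) :
  susp_map (F + G) = susp_map F + susp_map G.
Proof.
have [[f ->] [g ->]] := (qmor_onto F, qmor_onto G).
have [[s sf] [t tg]] := (susp_lift f, susp_lift g).
rewrite -qmorD (susp_mapE sf) (susp_mapE tg) -qmorD.
by apply: susp_mapE; rewrite mcompDl fmapD mcompDr sf tg.
Qed.

Definition suspension : add_functor D D :=
  AddFunctor susp_map1 susp_map_comp susp_mapD.

Lemma suspensionE X Y (f : Mor (qob X) (qob Y)) s :
  conn Y \oc s = fmap S f \oc conn X -> fmap suspension (qmor f) = qmor s.
Proof. exact: susp_mapE. Qed.

(** If s is a morphism of suspensions, then c_Y s vanishes on the object of M
    in the triangle that defines ΣX, so it factors through c_X, as f[1] c_X. *)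
Lemma suspension_full : full suspension.
Proof.
move=> X Y s0; have [s ->] := qmor_onto s0.
have [N [a [b [[MN aM] abc]]]] := conn_suspends X.
have sb : (conn Y \oc s) \oc b = 0 by rewrite mcompA conn_kills.
have [t] := triangle_coexact2 abc sb.
have [f <-] := equivalence_full (shift_equivalence T) t.
by move=> /susp_mapE fs; exists (qmor f).
Qed.

(** If f and g have equal suspensions then (f - g)[1] kills c_X, so f - g
    factors through the approximation of X. *)
Lemma suspension_faithful : faithful suspension.
Proof.
move=> X Y f0 g0; have [[f ->] [g ->]] := (qmor_onto f0, qmor_onto g0).
have [[s sf] [t tg]] := (susp_lift f, susp_lift g).
rewrite (suspensionE sf) (suspensionE tg) => /conn_comp_eq.
rewrite sf tg => fg; apply/qmor_eq.
have [N [a [b [[MN aM] abc]]]] := conn_suspends X.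
have [w0] : exists w, fmap S (f - g) = w \oc fmap S a.
  apply: (triangle_coexact3 abc).
  by rewrite fmapD fmapN mcompDr mcompNr fg subrr.
have [w <-] := equivalence_full (shift_equivalence T) w0.
rewrite -fmap_comp => /(equivalence_faithful (shift_equivalence T)) ->.
by exists N, a, w.
Qed.

(** The suspension does not depend on the approximation: each of the two
    connecting morphisms is a ghost, so it factors through the other. *)
Lemma suspends_unique (X Y : D) (c : Mor (qob Y) (S (qob X))) :
  suspends M c ->
  exists s : Mor (qob (susp X)) (qob Y), c \oc s = conn X /\ is_iso (qmor s).
Proof.
move=> cX; have [s cs] := ghost_lift cX (suspends_ghost (conn_suspends X)).
have [t ct] := conn_lift (suspends_ghost cX).
exists s; split=> //; exists (qmor t); rewrite -!qmor_comp -!qmor_id; split.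
  by apply: conn_inj; rewrite -mcompA ct cs mcomp1m.
apply/qmor_eq/(suspends_factors cX).
by rewrite mcompDl mcompNl -mcompA cs ct mcomp1m subrr.
Qed.

(** The hypothesis on cocones turns a right M-approximation of Y into a left
    M-approximation of an object with suspension Y. *)
Lemma suspension_essentially_surjective : essentially_surjective suspension.
Proof.
move=> Y; have [_ [N [g [MN gM]]]] := M_finite (svalP Y).
have [B [f [h fgh]]] := triangle_cocone T g.
have [ZB fM] := Z_cocone (MZ MN) (svalP Y) gM fgh.
have [s [_ s_iso]] : exists s : Mor (qob (susp (exist _ B ZB))) (qob Y),
    h \oc s = conn _ /\ is_iso (@qmor (susp _) _ s).
  by apply: suspends_unique; exists N, f, g.
by exists (exist _ B ZB : D), (@qmor (susp _) _ s).
Qed.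

(** ** The triangles *)

(** The M-monomorphism condition on a is built into the form of the last
    morphism, by [M_mono_ghost]. *)
Definition standard (X Y W : D) (a : Mor (qob X) (qob Y))
    (b : Mor (qob Y) (qob W)) (d : Mor (qob W) (qob (susp X))) :=
  triangle T a b (conn X \oc d).

Definition qtriangle (X Y W : D)
    (F : Mor X Y) (G : Mor Y W) (H : Mor W (suspension X)) :=
  exists (X' Y' W' : D) (a : Mor (qob X') (qob Y')) (b : Mor (qob Y') (qob W'))
    (d : Mor (qob W') (qob (susp X')))
    (A : Mor X' X) (B : Mor Y' Y) (E : Mor W' W),
  [/\ standard a b d, [/\ is_iso A, is_iso B & is_iso E],
      B \oc qmor a = F \oc A, E \oc qmor b = G \oc B
    & fmap suspension A \oc qmor d = H \oc E].

Lemma qtriangle_standard X Y W (a : Mor (qob X) (qob Y))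
    (b : Mor (qob Y) (qob W)) (d : Mor (qob W) (qob (susp X))) :
  standard a b d -> @qtriangle X Y W (qmor a) (qmor b) (qmor d).
Proof.
move=> abd; exists X, Y, W, a, b, d, (idm X), (idm Y), (idm W).
split=> //; first by split; exact: is_iso_id.
- by rewrite mcompm1 mcomp1m.
- by rewrite mcompm1 mcomp1m.
- by rewrite fmap1 mcompm1 mcomp1m.
Qed.

Lemma qtriangle_iso (X Y W X' Y' W' : D)
    (f : Mor X Y) (g : Mor Y W) (h : Mor W (suspension X))
    (f' : Mor X' Y') (g' : Mor Y' W') (h' : Mor W' (suspension X'))
    (a : Mor X X') (b : Mor Y Y') (c : Mor W W') :
  is_iso a -> is_iso b -> is_iso c ->
  b \oc f = f' \oc a -> c \oc g = g' \oc b ->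
  fmap suspension a \oc h = h' \oc c ->
  qtriangle f g h -> qtriangle f' g' h'.
Proof.
move=> ai bi ci bf cg ah [X0 [Y0 [W0 [a0 [b0 [d0 [A [B [E
  [std [Ai Bi Ei] fA gB hE]]]]]]]]]].
exists X0, Y0, W0, a0, b0, d0, (a \oc A), (b \oc B), (c \oc E); split=> //.
- by split; apply: is_iso_comp.
- by rewrite mcompA fA -!mcompA bf.
- by rewrite mcompA gB -!mcompA cg.
- by rewrite fmap_comp mcompA hE -!mcompA ah.
Qed.

Lemma qtriangle_id X O : is_zero_ob O ->
  qtriangle (idm X) (0 : Mor X O) (0 : Mor O (suspension X)).
Proof.
move=> O0; have [O1 [ZO1 O10]] := subcat_zero Z.
pose O' : D := exist _ O1 ZO1.
have std : standard (idm (qob X)) (0 : Mor _ (qob O')) (0 : Mor (qob O') _).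
  by rewrite /standard mcomp0m; apply: triangle_id.
have O'0 : idm O' = 0.
  by rewrite -qmor_id [idm _](O10 _).1; apply: quot_class0.
have := qtriangle_standard std.
apply: (qtriangle_iso (is_iso_id X) (is_iso_id X) (c := 0)).
- exists (0 : Mor O O'); rewrite O'0 mcompm0 mcomp0m.
  by split=> //; apply/esym/(O0 _).1.
- by rewrite mcompm1.
- by rewrite !(mcompm0, mcomp0m).
- by rewrite mcompm0 fmap1 mcompm1; apply: quot_class0.
Qed.

Lemma biproduct_of_M (Y : D) (N : C) : M N ->
  exists (B : D) (i1 : Mor (qob Y) (qob B)) (i2 : Mor N (qob B))
    (p1 : Mor (qob B) (qob Y)) (p2 : Mor (qob B) N),
  [/\ [/\ p1 \oc i1 = idm _, p2 \oc i2 = idm _, p2 \oc i1 = 0, p1 \oc i2 = 0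
        & i1 \oc p1 + i2 \oc p2 = idm _], is_iso (qmor i1) & is_iso (qmor p1)].
Proof.
move=> MN; have [B [ZB [i1 [i2 [p1 [p2 [e11 e22 e21 e12 e]]]]]]] :=
  subcat_biproduct (svalP Y) (MZ MN).
exists (exist _ B ZB), i1, i2, p1, p2.
have pi : @qmor (exist _ B ZB) Y p1 \oc @qmor Y (exist _ B ZB) i1 = idm Y.
  by rewrite -qmor_comp e11.
have ip : @qmor Y (exist _ B ZB) i1 \oc @qmor (exist _ B ZB) Y p1
    = idm (exist _ B ZB : D).
  rewrite -qmor_comp -qmor_id; apply/esym/qmor_eq; rewrite -e.
  by exists N, p2, i2; rewrite addrAC subrr add0r.
split=> //; first by exists (@qmor (exist _ B ZB) Y p1).
by exists (@qmor Y (exist _ B ZB) i1).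
Qed.

(** Adding to f the components of a left M-approximation of its source does
    not change it up to isomorphism in the quotient. *)
Lemma M_mono_replacement (X Y : D) (f : Mor (qob X) (qob Y)) :
  exists (Y' : D) (f' : Mor (qob X) (qob Y')) (B : Mor Y Y'),
    [/\ M_mono M f', is_iso B & B \oc qmor f = qmor f'].
Proof.
have [[N [a [MN aM]]] _] := M_finite (svalP X).
have [B [i1 [i2 [p1 [p2 [[e11 e22 e21 e12 e] i1_iso _]]]]]] :=
  biproduct_of_M Y MN.
exists B, (i1 \oc f + i2 \oc a), (qmor i1); split=> //.
  move=> N' MN' u; have [v <-] := aM N' MN' u; exists (v \oc p2).
  by rewrite mcompDl !mcompA -![p2 \oc (_ \oc _)]mcompA e21 e22 mcompm0 mcompm1
    mcomp0m add0r.
rewrite -qmor_comp; apply/esym/qmor_eq; rewrite addrAC subrr add0r.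
by exists N, a, i2.
Qed.

Lemma standard_cone (X Y : D) (f : Mor (qob X) (qob Y)) : M_mono M f ->
  exists (W : D) (b : Mor (qob Y) (qob W)) (d : Mor (qob W) (qob (susp X))),
    standard f b d.
Proof.
move=> fM; have [W [b [h fbh]]] := triangle_cone T f.
have [ZW _] := Z_cone (svalP X) (svalP Y) fM fbh.
have [d hd] := conn_lift (proj1 (M_mono_ghost M fbh) fM).
by exists (exist _ W ZW), b, d; rewrite /standard hd.
Qed.

Lemma qtriangle_cone (X Y : D) (F : Mor X Y) :
  exists (W : D) (G : Mor Y W) (H : Mor W (suspension X)), qtriangle F G H.
Proof.
have [f ->] := qmor_onto F.
have [Y' [f' [B [f'M [B' [B'B BB']] Bf]]]] := M_mono_replacement f.
have [W [b [d std]]] := standard_cone f'M.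
exists W, (qmor b \oc B), (qmor d); have := qtriangle_standard std.
apply: (qtriangle_iso (is_iso_id X) (b := B') _ (is_iso_id W)).
- by exists B.
- by rewrite -Bf -mcompA B'B mcompm1 mcomp1m.
- by rewrite mcompA BB' mcompm1 mcomp1m.
- by rewrite fmap1 mcompm1 mcomp1m.
Qed.

(** A square that commutes modulo [M] is made to commute in C by a change of
    its right-hand side: the difference factors through M, so it extends along
    the M-monomorphism a. *)
Lemma standard_fill (X Y W X' Y' W' : D)
    (a : Mor (qob X) (qob Y)) (b : Mor (qob Y) (qob W))
    (d : Mor (qob W) (qob (susp X)))
    (a' : Mor (qob X') (qob Y')) (b' : Mor (qob Y') (qob W'))
    (d' : Mor (qob W') (qob (susp X')))
    (A : Mor X X') (B : Mor Y Y') :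
  standard a b d -> standard a' b' d' -> B \oc qmor a = qmor a' \oc A ->
  exists E : Mor W W', E \oc qmor b = qmor b' \oc B /\
    fmap suspension A \oc qmor d = qmor d' \oc E.
Proof.
move=> std std'; have [[x ->] [y ->]] := (qmor_onto A, qmor_onto B).
rewrite -[qmor y \oc _]qmor_comp -[qmor a' \oc _]qmor_comp.
move=> /qmor_eq[N [u [v [MN yx]]]].
have aM : M_mono M a.
  exact/(M_mono_ghost M std)/ghost_comp/suspends_ghost/conn_suspends.
have [w wa] := aM N MN u.
have ya : (y - v \oc w) \oc a = a' \oc x.
  by apply: subr0_eq; rewrite mcompDr mcompNr mcompA wa -yx subKr subrr.
have -> : qmor y = qmor (y - v \oc w).
  by apply/qmor_eq; exists N, w, v; rewrite opprB addrCA subrr addr0.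
have [e [eb xe]] := triangle_fill std std' ya.
have [s sx] := susp_lift x.
exists (qmor e); rewrite (suspensionE sx) -!qmor_comp eb; split=> //.
by apply: conn_inj; rewrite -!mcompA sx mcompA xe mcompA.
Qed.

Lemma qtriangle_fill (X Y W X' Y' W' : D)
    (f : Mor X Y) (g : Mor Y W) (h : Mor W (suspension X))
    (f' : Mor X' Y') (g' : Mor Y' W') (h' : Mor W' (suspension X'))
    (a : Mor X X') (b : Mor Y Y') :
  qtriangle f g h -> qtriangle f' g' h' -> b \oc f = f' \oc a ->
  exists c : Mor W W', c \oc g = g' \oc b /\
    fmap suspension a \oc h = h' \oc c.
Proof.
move=> [X0 [Y0 [W0 [f0 [g0 [h0 [A [B [E
  [std [Ai Bi [E' [E'E EE']]] fA gB hE]]]]]]]]]].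
move=> [X1 [Y1 [W1 [f1 [g1 [h1 [A1 [B1 [E1
  [std1 [[A1' [A1'A A1A1']] [B1' [B1'B B1B1']] E1i] fA1 gB1 hE1]]]]]]]]]] bf.
have [|c [cg ch]] := @standard_fill _ _ _ _ _ _ _ _ _ _ _ _
    (A1' \oc a \oc A) (B1' \oc b \oc B) std std1.
  apply: (is_iso_mono (f := B1)); first by exists B1'.
  rewrite -!mcompA B1B1' mcompm1 fA1 mcompA fA -mcompA bf.
  by rewrite [f' \oc A1 \oc A1']mcompA A1A1' mcomp1m.
exists (E1 \oc c \oc E'); split.
  apply: (is_iso_epi Bi); rewrite !mcompA -gB -[E' \oc _]mcompA E'E mcompm1 cg.
  by rewrite -mcompA gB1 !mcompA -[B1 \oc (B1' \oc _)]mcompA B1B1' mcompm1.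
apply: (is_iso_epi (f := E)); first by exists E'.
rewrite !mcompA -hE E'E mcomp1m -[RHS]mcompA -hE1 mcompA -ch.
have aA : fmap suspension A1 \oc fmap suspension (A1' \oc a \oc A) =
    fmap suspension a \oc fmap suspension A.
  by rewrite -!fmap_comp -!mcompA A1A1' mcompm1.
by rewrite -!mcompA aA.
Qed.

(** To rotate X -a-> Y -b-> W -d-> ΣX, the morphism b is replaced by the
    M-monomorphism u = (b, i) : Y -> W (+) N, for a left M-approximation i of
    Y. Let K be the cone of u. The projection W (+) N -> W induces A from the
    cone K of u to the cone X[1] of b. Like c_X, it is a ghost through which
    c_X factors, and its kernel consists of morphisms that factor through N.
    So K is isomorphic to ΣX in the quotient, by the argument of
    [suspends_unique]. *)
Lemma standard_rot (X Y W : D) (a : Mor (qob X) (qob Y))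
    (b : Mor (qob Y) (qob W)) (d : Mor (qob W) (qob (susp X))) :
  standard a b d ->
  @qtriangle Y W (suspension X) (qmor b) (qmor d) (- fmap suspension (qmor a)).
Proof.
move=> std; have aM : M_mono M a.
  exact/(M_mono_ghost M std)/ghost_comp/suspends_ghost/conn_suspends.
have [[N [i [MN iM]]] _] := M_finite (svalP Y).
have [B [i1 [i2 [p1 [p2 [[e11 e22 e21 e12 e] _ p1_iso]]]]]] :=
  biproduct_of_M W MN.
pose u : Mor (qob Y) (qob B) := i1 \oc b + i2 \oc i.
have p1u : p1 \oc u = b.
  by rewrite mcompDl -!mcompA e11 e12 mcompm1 mcompm0 addr0.
have p2u : p2 \oc u = i.
  by rewrite mcompDl -!mcompA e21 e22 mcompm1 mcompm0 add0r.
have uM : M_mono M u.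
  by move=> N' MN' y; have [v <-] := iM N' MN' y; exists (v \oc p2);
    rewrite mcompA p2u.
have [K [w [l uwl]]] := standard_cone uM.
have ub : p1 \oc u = b \oc idm _ by rewrite p1u mcomp1m.
have [A [Aw]] := triangle_fill uwl (proj1 (triangle_rot _ _ _) std) ub.
rewrite fmap1 mcompm1 => lA.
(* Any morphism from X to an object of M is of the form v' i a, and
   i a = p2 u a, while u[1] a[1] A = - u[1] c_Y l = 0. *)
have A_ghost : ghost M A.
  move=> N' MN' y; have [v <-] := aM N' MN' y; have [v' <-] := iM N' MN' v.
  rewrite fmap_comp mcompA; have := lA; rewrite mcompNr => /eqP.
  rewrite eq_sym eqr_oppLR => /eqP ->; rewrite mcompNl -p2u.
  by rewrite !fmap_comp !mcompA (triangle_comp0_rot2 uwl) !mcomp0m oppr0.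
have [t At] := conn_lift A_ghost.
(* c_X lifts to K up to a correction: - a[1] c_X is killed by u[1], so it is
   c_Y l s0, and c_X - A s0, being killed by a[1], comes from W. *)
have [s sA] : exists s : Mor (qob (susp X)) (qob K), A \oc s = conn X.
  have [s0 as0] : exists s0, - fmap S a \oc conn X = conn Y \oc l \oc s0.
    apply: (triangle_exact3 uwl); rewrite -mcompA mcompNl -fmap_comp.
    have -> : u \oc a = i2 \oc (i \oc a).
      by rewrite mcompDr !mcompA (triangle_comp0 std) mcomp0m add0r.
    rewrite fmap_comp mcompNr mcompA.
    by rewrite (suspends_ghost (conn_suspends X) MN) mcomp0m oppr0.
  have [r0 r0E] : exists r0, conn X - A \oc s0 = conn X \oc d \oc r0.
    apply: (triangle_exact3 std); apply: oppr_inj.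
    by rewrite -mcompNr mcompDl mcompNl as0 -mcompA -lA subrr oppr0.
  exists (s0 + w \oc (i1 \oc r0)); rewrite mcompDl -mcompA Aw.
  by rewrite mcompA -[p1 \oc _]mcompA e11 mcompm1 -r0E addrC subrK.
(* If A x = 0 then x = w y with p1 y = b r, and w y = w (y - u r), where
   y - u r has only a component in N. *)
have A_kernel (x : Mor (qob K) (qob K)) : A \oc x = 0 -> factors_through M x.
  move=> Ax; have [y xy] : exists y, x = w \oc y.
    by apply: (triangle_exact2 uwl); rewrite lA mcompA Ax mcomp0m.
  have [r p1y] : exists r, p1 \oc y = b \oc r.
    by apply: (triangle_exact2 std); rewrite -mcompA -Aw mcompA -xy.
  exists N, (p2 \oc y - i \oc r), (w \oc i2); split=> //.
  rewrite xy -[y in LHS]mcompm1 -e mcompDr mcompA p1y [i2 \oc p2 \oc y]mcompA.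
  have -> : i1 \oc (b \oc r) = u \oc r - i2 \oc (i \oc r).
    by rewrite mcompDr !mcompA addrK.
  rewrite [w \oc i2 \oc _]mcompA !mcompDl !mcompNl -[w \oc (u \oc r)]mcompA.
  by rewrite (triangle_comp0 uwl) mcompm0 add0r addrC.
have t_iso : is_iso (qmor t).
  exists (qmor s); split; rewrite -qmor_comp -qmor_id.
    apply/qmor_eq/A_kernel.
    by rewrite mcompDl mcompNl -mcompA sA At mcomp1m subrr.
  by apply: conn_inj; rewrite -mcompA At sA mcomp1m.
apply: (qtriangle_iso (is_iso_id Y) p1_iso t_iso _ _ _
  (qtriangle_standard uwl)).
- by rewrite -qmor_comp p1u mcomp1m.
- rewrite -!qmor_comp; apply: conn_inj.
  by rewrite -!mcompA At Aw.
- have [s' s'a] := susp_lift a.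
  rewrite fmap1 mcompm1 (suspensionE s'a) mcompNr -qmor_comp -qmorN.
  apply: conn_inj.
  by rewrite lA mcompNl -mcompA s'a mcompA At mcompNr.
Qed.

Lemma qtriangle_rot (X Y W : D)
    (f : Mor X Y) (g : Mor Y W) (h : Mor W (suspension X)) :
  qtriangle f g h -> qtriangle g h (- fmap suspension f).
Proof.
move=> [X0 [Y0 [W0 [a [b [d [A [B [E [std [Ai Bi Ei] fA gB hE]]]]]]]]]].
have := standard_rot std.
apply: (qtriangle_iso Bi Ei (is_iso_fmap suspension Ai)) => //.
by rewrite mcompNl mcompNr -!fmap_comp fA.
Qed.

(** The octahedron in C is already one of standard triangles: its triangle on
    the cones ends with p[1] c_Y e, which is c_U s e for a morphism s that
    represents Σp. *)
Lemma standard_octahedral (X Y W U V R : D)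
    (f : Mor (qob X) (qob Y)) (p : Mor (qob Y) (qob U))
    (d : Mor (qob U) (qob (susp X)))
    (g : Mor (qob Y) (qob W)) (r : Mor (qob W) (qob R))
    (e : Mor (qob R) (qob (susp Y)))
    (q : Mor (qob W) (qob V)) (k : Mor (qob V) (qob (susp X))) :
  standard f p d -> standard g r e -> standard (g \oc f) q k ->
  exists (a : Mor (U : D) V) (b : Mor (V : D) R),
    [/\ qtriangle a b (fmap suspension (qmor p) \oc qmor e),
        a \oc qmor p = qmor q \oc qmor g, qmor k \oc a = qmor d,
        b \oc qmor q = qmor r
      & qmor e \oc b = fmap suspension (qmor f) \oc qmor k].
Proof.
move=> Tf Tg Tgf.
have [a [b [Tab ap ka bq eb]]] := triangle_octahedral Tf Tg Tgf.
have [[s sp] [t tf]] := (susp_lift p, susp_lift f).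
exists (qmor a), (qmor b); rewrite (suspensionE sp) (suspensionE tf).
rewrite -!qmor_comp ap bq; split=> //.
- by apply: qtriangle_standard; rewrite /standard -mcompA sp mcompA.
- by apply: conn_inj; rewrite -mcompA.
- by apply: conn_inj; rewrite -!mcompA eb tf mcompA.
Qed.

Lemma qtriangle_octahedral (X Y W : D) (F : Mor X Y) (G : Mor Y W) :
  exists (U V R : D)
    (p : Mor Y U) (d : Mor U (suspension X)) (r : Mor W R)
    (e : Mor R (suspension Y)) (q : Mor W V) (k : Mor V (suspension X))
    (a : Mor U V) (b : Mor V R),
    [/\ qtriangle F p d, qtriangle G r e, qtriangle (G \oc F) q k
      & [/\ qtriangle a b (fmap suspension p \oc e),
          a \oc p = q \oc G, k \oc a = d,
          b \oc q = r & e \oc b = fmap suspension F \oc k]].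
Proof.
have [f Ff] := qmor_onto F.
have [Y' [f' [B [f'M [B' [B'B BB']]]]]] := M_mono_replacement f.
rewrite -Ff => BF; have [g Gg] := qmor_onto (G \oc B').
have [W' [g' [E [g'M [E' [E'E EE']]]]]] := M_mono_replacement g.
rewrite -Gg => EGB'; have EG : E \oc G = qmor g' \oc B.
  by rewrite -EGB' !mcompA B'B mcomp1m.
have gf'M : M_mono M (g' \oc f').
  move=> N MN y; have [v <-] := f'M N MN y; have [v' <-] := g'M N MN v.
  by exists v'; rewrite mcompA.
have [U [p [d Tf]]] := standard_cone f'M.
have [R [r [e Tg]]] := standard_cone g'M.
have [V [q [k Tgf]]] := standard_cone gf'M.
have [a [b [Tab ap ka bq eb]]] := standard_octahedral Tf Tg Tgf.
have B'_iso : is_iso B' by exists B.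
have E'_iso : is_iso E' by exists E.
exists U, V, R, (qmor p \oc B), (qmor d), (qmor r \oc E),
  (fmap suspension B' \oc qmor e), (qmor q \oc E), (qmor k), a, b.
split; last split=> //.
- apply: (qtriangle_iso (is_iso_id X) B'_iso (is_iso_id U) _ _ _
    (qtriangle_standard Tf)).
  + by rewrite -BF -mcompA B'B mcompm1 mcomp1m.
  + by rewrite mcompA BB' mcompm1 mcomp1m.
  + by rewrite fmap1 mcompm1 mcomp1m.
- apply: (qtriangle_iso B'_iso E'_iso (is_iso_id R) _ _ _
    (qtriangle_standard Tg)).
  + by rewrite -EGB' -!mcompA E'E mcompm1.
  + by rewrite mcompA EE' mcompm1 mcomp1m.
  + by rewrite mcomp1m.
- apply: (qtriangle_iso (is_iso_id X) E'_iso (is_iso_id V) _ _ _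
    (qtriangle_standard Tgf)).
  + rewrite qmor_comp -BF -[qmor g' \oc _]mcompA -EG.
    by rewrite -!mcompA E'E mcompm1 mcomp1m.
  + by rewrite mcompA EE' mcompm1 mcomp1m.
  + by rewrite fmap1 mcompm1 mcomp1m.
- have pB : fmap suspension (qmor p \oc B) \oc fmap suspension B' =
      fmap suspension (qmor p) by rewrite -fmap_comp mcompA BB' mcomp1m.
  by rewrite -mcompA pB.
- by rewrite -mcompA ap !mcompA EG.
- by rewrite -mcompA bq.
- have Bf : fmap suspension B' \oc fmap suspension (qmor f') =
      fmap suspension F by rewrite -fmap_comp -BF -mcompA B'B mcompm1.
  by rewrite mcompA eb -mcompA Bf.
Qed.

Definition quotient_weak_triangulation : weak_triangulation D :=
  WeakTriangulation suspension_full suspension_faithful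
    suspension_essentially_surjective qtriangle_iso qtriangle_id
    qtriangle_cone qtriangle_rot qtriangle_fill qtriangle_octahedral.

End Quotient.

Theorem theorem1p1 (C : add_category) (T : triangulation C) (M Z : add_subcat C)
  (MZ : forall X : C, M X -> Z X)
  (H1 : functorially_finite M Z)
  (H2a : forall (Z1 Z2 K : C)
      (f : Mor Z1 Z2) (g : Mor Z2 K) (h : Mor K (shift T Z1)),
    Z Z1 -> Z Z2 -> M_mono M f -> triangle T f g h -> Z K /\ M_epi M g)
  (H2b : forall (B Z2 Z3 : C)
      (f : Mor B Z2) (g : Mor Z2 Z3) (h : Mor Z3 (shift T B)),
    Z Z2 -> Z Z3 -> M_epi M g -> triangle T f g h -> Z B /\ M_mono M f) :
  inhabited (triangulation (quot_cat Z M)).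
Proof.
exact: inhabits (triangulation_of_weak
  (quotient_weak_triangulation MZ H1 H2a H2b)).
Qed.
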